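(* $\vec V$ is a subgroup of Thompson's group $V$.
   Context: **Thompson's group $V$.** All trees are finite planar rooted binary trees (each non-leaf vertex has a left child and a right child); leaves are numbered from left to right. A tree with $n$ leaves determines a partition of $[0,1)$ into $n$ half-open standard dyadic intervals by repeated halving. A triple $(T_+,T_-,\sigma)$, where $T_+,T_-$ are trees with the same number $n$ of leaves and $\sigma\in S_n$, represents the bijection of $[0,1)$ mapping, affinely and increasingly, the $i$-th interval of $T_+$ onto the $\sigma(i)$-th interval of $T_-$. Thompson's group $V$ is the group of all such bijections under composition. Adding a canceling caret to a triple means: for some $i$, attach a caret (two new leaf children) to the $i$-th leaf of $T_+$ and to the $\sigma(i)$-th leaf of $T_-$, and change $\sigma$ to the permutation matching the new left leaf with the new left leaf, the new right leaf with the new right leaf, and all other leaves as before. Two triples represent the same element iff they are related by adding/removing canceling carets; a triple is reduced if no canceling caret can be removed, and each element of $V$ has a unique reduced triple. **Signs.** To a tree $T$ with $n$ leaves one associates its $n$-sign $n(T)=(\varepsilon_1,\dots,\varepsilon_n)\in\{+,-\}^n$, determined by $\varepsilon_1=+$ and, for each non-leaf vertex $w$ of $T$, $\varepsilon_b=-\varepsilon_a$, where $a$ is the leftmost leaf below $w$ and $b$ is the leftmost leaf below the right child of $w$. (Geometrically, these are the signs of the bands, from left to right, of the checkerboard surface of the tangle associated with $T$, oriented with leftmost band positive.) For $\sigma\in S_n$ and a sign sequence $\nu$, $\sigma(\nu)$ is the image of $\nu$ under $\sigma$: its $\sigma(i)$-th entry is the $i$-th entry of $\nu$. $-\nu$ is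 $\nu$ with all signs switched. **Definition of $\vec V$.** $\vec V$ is the subset of $V$ consisting of the elements whose reduced triple $(T_+,T_-,\sigma)$ satisfies $\sigma(n(T_+))=\pm n(T_-)$. *)

(* Defs.v *)
From HB Require Import structures.
From mathcomp Require Import all_boot all_order all_algebra all_fingroup.
From mathcomp Require Import boolp reals.
From mathcomp Require Import zify ring lra.

Set Implicit Arguments.
Unset Strict Implicit.
Unset Printing Implicit Defensive.

Import Order.TTheory GRing.Theory Num.Theory.
Local Open Scope ring_scope.

Inductive tree := Leaf | Node (l r : tree).

Fixpoint nleaves (T : tree) : nat :=
  if T is Node l r then (nleaves l + nleaves r)%N else 1%N.

(* The caret goes on the i-th leaf, counted from 0; meaningful for
   i < nleaves T only. *)
Fixpoint attach (T : tree) (i : nat) : tree :=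
  if T is Node l r then
    if (i < nleaves l)%N then Node (attach l i) r
    else Node l (attach r (i - nleaves l))
  else Node Leaf Leaf.

Lemma nleaves_attach T i : nleaves (attach T i) = (nleaves T).+1.
Proof.
elim: T i => [|l IHl r IHr] i //=.
by case: ifP => _ /=; rewrite ?IHl ?IHr ?addSn ?addnS.
Qed.

Record triple := Triple {
  tsize : nat;
  tplus : tree;
  tminus : tree;
  tperm : 'S_tsize;
  tplus_size : nleaves tplus = tsize;
  tminus_size : nleaves tminus = tsize }.

Lemma caret_size T n i : nleaves T = n -> nleaves (attach T i) = n.+1.
Proof. by move=> <-; exact: nleaves_attach. Qed.

(* Splitting leaf i makes leaves i and i+1 out of it, so that the other old
   leaves are renumbered by [lift (i+1)], which also sends i to the new left
   leaf.  With j = sigma i, the permutation below thus sends the new right leaf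
   i+1 to j+1, the new left leaf i to j, and agrees with sigma elsewhere. *)
Definition add_caret (t : triple) (i : 'I_(tsize t)) : triple :=
  Triple (lift_perm (lift ord0 i) (lift ord0 (tperm t i)) (tperm t))
    (caret_size i (tplus_size t)) (caret_size (tperm t i) (tminus_size t)).

Definition reduced (t : triple) : Prop :=
  ~ exists (t0 : triple) (i : 'I_(tsize t0)), t = add_caret i.

(* Signs are booleans, [true] standing for +.  [signs s T] are the signs of the
   leaves of T when the leftmost one has sign s; see [signsP]. *)
Fixpoint signs (s : bool) (T : tree) : seq bool :=
  if T is Node l r then signs s l ++ signs (~~ s) r else [:: s].

(* [sign_rule e k T]: the alternation rule holds at every non-leaf vertex of T,
   where T sits inside a larger tree and its leftmost leaf has number k there. *)
Fixpoint sign_rule (e : nat -> bool) (k : nat) (T : tree) : Prop :=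
  if T is Node l r then
    [/\ e (k + nleaves l)%N = ~~ e k,
        sign_rule e k l & sign_rule e (k + nleaves l)%N r]
  else True.

Lemma size_signs s T : size (signs s T) = nleaves T.
Proof. by elim: T s => //= l IHl r IHr s; rewrite size_cat IHl IHr. Qed.

Lemma nleaves_gt0 T : (0 < nleaves T)%N.
Proof. by elim: T => //= l IHl r _; rewrite addn_gt0 IHl. Qed.

Lemma nth0_signs s T : nth true (signs s T) 0 = s.
Proof.
by elim: T s => //= l IHl r _ s; rewrite nth_cat size_signs nleaves_gt0.
Qed.

Lemma sign_ruleP e k T :
  sign_rule e k T <->
  forall i, (i < nleaves T)%N -> e (k + i)%N = nth true (signs (e k) T) i.
Proof.
elim: T k => [|l IHl r IHr] k /=; first by split=> // _ [|//]; rewrite addn0.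
split=> [[ekl /IHl hl /IHr hr] i ilt|h].
  rewrite nth_cat size_signs; case: ltnP => [/hl->|li] //.
  by have := hr (i - nleaves l)%N; rewrite -addnA subnKC // ekl; apply; lia.
have ekl : e (k + nleaves l)%N = ~~ e k.
  have := h (nleaves l); rewrite nth_cat size_signs ltnn subnn nth0_signs.
  by apply; have := nleaves_gt0 r; lia.
split=> //; [apply/IHl|apply/IHr] => i ilt.
  by rewrite h ?nth_cat ?size_signs ?ilt ?ltn_addr.
rewrite -addnA h ?ltn_add2l // nth_cat size_signs ltnNge leq_addr /=.
by rewrite addKn ekl.
Qed.

Lemma signsP T (e : seq bool) : size e = nleaves T ->
  e = signs true T <-> nth true e 0 = true /\ sign_rule (nth true e) 0 T.
Proof.
move=> se; split=> [eE|[e0 /sign_ruleP]].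
  have e0 : nth true e 0 = true by rewrite eE nth0_signs.
  by split=> //; apply/sign_ruleP => i _; rewrite e0 -eE.
rewrite e0 => h; apply: (@eq_from_nth _ true); rewrite ?size_signs // => i.
by rewrite se => /h.
Qed.

Definition nsign (n : nat) (T : tree) : {ffun 'I_n -> bool} :=
  [ffun i : 'I_n => nth true (signs true T) i].

Definition perm_signs n (s : 'S_n) (nu : {ffun 'I_n -> bool}) :
  {ffun 'I_n -> bool} := [ffun j => nu ((s^-1)%g j)].

Definition opp_signs n (nu : {ffun 'I_n -> bool}) : {ffun 'I_n -> bool} :=
  [ffun j => ~~ nu j].

Definition compatible_signs (t : triple) : Prop :=
  let np := nsign (tsize t) (tplus t) in
  let nm := nsign (tsize t) (tminus t) in
  perm_signs (tperm t) np = nm \/ perm_signs (tperm t) np = opp_signs nm.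

Section UnitInterval.
Variable R : realType.

Definition unit_itv := {x : R | 0 <= x < 1}.

Record ubij := UBij {
  ufun :> unit_itv -> unit_itv;
  uinv : unit_itv -> unit_itv;
  ufunK : cancel ufun uinv;
  uinvK : cancel uinv ufun }.

Lemma ubijP (f g : ubij) : (forall x, f x = g x) -> f = g.
Proof.
case: f g => [f f' fK f'K] [g g' gK g'K] /= fg.
have efg : f = g by apply/funext.
have efg' : f' = g' by apply/funext => x; rewrite -{1}(g'K x) -fg fK.
by subst g g'; congr UBij; exact: Prop_irrelevance.
Qed.

HB.instance Definition _ := gen_eqMixin ubij.
HB.instance Definition _ := gen_choiceMixin ubij.

Definition ubij1 : ubij := @UBij id id (fun=> erefl) (fun=> erefl).
Definition ubijV (f : ubij) : ubij := UBij (@uinvK f) (@ufunK f).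
(* [ubijM f g] is x |-> f (g x). *)
Definition ubijM (f g : ubij) : ubij :=
  UBij (can_comp (@ufunK f) (@ufunK g)) (can_comp (@uinvK g) (@uinvK f)).

Lemma ubijMA : associative ubijM. Proof. by move=> f g h; exact: ubijP. Qed.
Lemma ubij1M : left_id ubij1 ubijM. Proof. by move=> f; exact: ubijP. Qed.
Lemma ubijM1 : right_id ubij1 ubijM. Proof. by move=> f; exact: ubijP. Qed.
Lemma ubijVM : left_inverse ubij1 ubijV ubijM.
Proof. by move=> f; apply: ubijP => x; exact: ufunK. Qed.
Lemma ubijMV : right_inverse ubij1 ubijV ubijM.
Proof. by move=> f; apply: ubijP => x; exact: uinvK. Qed.

HB.instance Definition _ :=
  isGroup.Build ubij ubijMA ubij1M ubijM1 ubijVM ubijMV.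

(* The leaf intervals of T, from left to right, when T subdivides [a, b[; the
   pair (c, d) stands for [c, d[. *)
Fixpoint leaf_itvs (a b : R) (T : tree) : seq (R * R) :=
  if T is Node l r then
    leaf_itvs a ((a + b) / 2) l ++ leaf_itvs ((a + b) / 2) b r
  else [:: (a, b)].

Definition leaf_itv (T : tree) (i : nat) : R * R :=
  nth (0, 0) (leaf_itvs 0 1 T) i.

Definition represents (t : triple) (f : ubij) : Prop :=
  forall (i : 'I_(tsize t)) (x : unit_itv),
    let: (a, b) := leaf_itv (tplus t) i in
    let: (c, d) := leaf_itv (tminus t) (tperm t i) in
    a <= val x < b -> val (f x) = c + (d - c) / (b - a) * (val x - a).

Lemma representsP t f : represents t f <->
  forall (i : 'I_(tsize t)) (x : unit_itv),
    let p := leaf_itv (tplus t) i in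
    let q := leaf_itv (tminus t) (tperm t i) in
    p.1 <= val x < p.2 ->
    val (f x) = q.1 + (q.2 - q.1) / (p.2 - p.1) * (val x - p.1).
Proof.
by split=> h i x; have := h i x; case: leaf_itv => a b; case: leaf_itv.
Qed.

Lemma size_leaf_itvs a b T : size (leaf_itvs a b T) = nleaves T.
Proof. by elim: T a b => //= l IHl r IHr a b; rewrite size_cat IHl IHr. Qed.

Lemma leaf_itvs_bounds T (a b : R) i : a < b -> (i < nleaves T)%N ->
  let p := nth (0, 0) (leaf_itvs a b T) i in
  [/\ a <= p.1, p.1 < p.2 & p.2 <= b].
Proof.
elim: T a b i => [|l IHl r IHr] a b i ab /=; first by case: i.
rewrite nth_cat size_leaf_itvs => ilt; case: ltnP => il.
  have am : a < (a + b) / 2 by lra.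
  by have [h1 h2 h3] := IHl _ _ _ am il; split=> //; lra.
have mb : (a + b) / 2 < b by lra.
have ir : (i - nleaves l < nleaves r)%N by lia.
by have [h1 h2 h3] := IHr _ _ _ mb ir; split=> //; lra.
Qed.

Lemma leaf_itv_bounds T i : (i < nleaves T)%N ->
  [/\ 0 <= (leaf_itv T i).1, (leaf_itv T i).1 < (leaf_itv T i).2
    & (leaf_itv T i).2 <= 1].
Proof. exact: leaf_itvs_bounds. Qed.

Lemma nth_leaf_itvs_attach T (a b : R) i k : (i < nleaves T)%N ->
  let s := leaf_itvs a b T in
  let p := nth (0, 0) s i in
  nth (0, 0) (leaf_itvs a b (attach T i)) k =
  if (k < i)%N then nth (0, 0) s k
  else if k == i then (p.1, (p.1 + p.2) / 2)
  else if k == i.+1 then ((p.1 + p.2) / 2, p.2) else nth (0, 0) s k.-1.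
Proof.
elim: T a b i k => [|l IHl r IHr] a b i k /=.
  by case: i => // _; case: k => [|[|k]] //=; rewrite !nth_nil.
move=> ilt; case: (ltnP i (nleaves l)) => il /=.
  rewrite !nth_cat !size_leaf_itvs nleaves_attach il.
  case: (ltnP k (nleaves l).+1) => kl.
    rewrite IHl //; case: ltnP => ki; first by rewrite (ltn_trans ki il).
    case: eqP => // ki1; case: eqP => // ki2.
    by rewrite (_ : (k.-1 < nleaves l)%N) //; lia.
  rewrite !ifN; [congr nth|..]; lia.
rewrite !nth_cat !size_leaf_itvs.
rewrite (ltnNge i) il /=; case: (ltnP k (nleaves l)) => kl.
  by rewrite (leq_trans kl il).
rewrite IHr; last by lia.
have -> : (k - nleaves l < i - nleaves l)%N = (k < i)%N by lia.
have -> : (k - nleaves l == i - nleaves l)%N = (k == i) by lia.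
have -> : (k - nleaves l == (i - nleaves l).+1)%N = (k == i.+1) by lia.
case: ifP => // ki; case: eqP => // ki1; case: eqP => // ki2.
by rewrite ifN; [congr nth|]; lia.
Qed.

Lemma leaf_itv_attach T i k : (i < nleaves T)%N ->
  leaf_itv (attach T i) k =
  let p := leaf_itv T i in
  if (k < i)%N then leaf_itv T k
  else if k == i then (p.1, (p.1 + p.2) / 2)
  else if k == i.+1 then ((p.1 + p.2) / 2, p.2) else leaf_itv T k.-1.
Proof. exact: nth_leaf_itvs_attach. Qed.

Lemma leaf_itv_bump T i k : (i < nleaves T)%N -> k != i ->
  leaf_itv (attach T i) (bump i.+1 k) = leaf_itv T k.
Proof.
move=> ilt ki; rewrite leaf_itv_attach // /bump /=.
case: (ltnP i k) => ik /=; last by rewrite add0n ifT //; lia.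
by rewrite !ifN //; lia.
Qed.

Lemma represents_add_caret t f (i : 'I_(tsize t)) :
  represents t f -> represents (add_caret i) f.
Proof.
case: t i => n A B s An Bn /= i /representsP /= h.
apply/representsP => /= k x.
have iA : (i < nleaves A)%N by rewrite An.
have jB : (s i < nleaves B)%N by rewrite Bn.
have [_ ha _] := leaf_itv_bounds iA.
case: (unliftP (lift ord0 i) k) => [k'|] -> {k}.
  rewrite lift_perm_lift /=; have [->|k'i] := eqVneq k' i.
    have bumpE m : bump (bump 0 m) m = m by rewrite /bump; lia.
    rewrite !bumpE !leaf_itv_attach // !ltnn !eqxx /= => hx.
    by rewrite (h i x) /=; [field; apply: lt0r_neq0|]; lra.
  rewrite !leaf_itv_bump //; first exact: h.
  by apply: contra k'i => /eqP/val_inj/perm_inj ->.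
rewrite lift_perm_id /=.
have bumpE m : ((bump 0 m < m)%N = false) * ((bump 0 m == m) = false).
  by rewrite /bump; split; lia.
rewrite !leaf_itv_attach // !bumpE /= /bump !add1n !eqxx /= => hx.
by rewrite (h i x) /=; [field; apply: lt0r_neq0|]; lra.
Qed.

Definition swap_triple (t : triple) : triple :=
  Triple (tperm t)^-1%g (tminus_size t) (tplus_size t).

Lemma affine_itv (a b c d y : R) : a < b -> c < d -> c <= y < d ->
  a <= a + (b - a) / (d - c) * (y - c) < b.
Proof.
move=> ab cd /andP[cy yd]; apply/andP; split.
  by rewrite lerDl mulr_ge0 ?divr_ge0 ?subr_ge0 // ltW.
rewrite -ltrBrDl -[ltRHS]mulr1 -mulrA ltr_pM2l ?subr_gt0 //.
by rewrite mulrC ltr_pdivrMr ?subr_gt0 // mul1r ltrD2r.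
Qed.

Lemma represents_swap t f :
  represents t f -> represents (swap_triple t) (f^-1)%g.
Proof.
case: t => n A B s An Bn /representsP /= h; apply/representsP => /= k y.
pose i := (s^-1)%g k; have sk : s i = k by rewrite permKV.
have iA : (i < nleaves A)%N by rewrite An.
have kB : (k < nleaves B)%N by rewrite Bn.
have [a0 ab b1] := leaf_itv_bounds iA.
have [c0 cd d1] := leaf_itv_bounds kB.
have {h} := h i; rewrite sk -/i.
case: (leaf_itv A i) (leaf_itv B k) a0 ab b1 c0 cd d1 => a b [c d] /=.
move=> a0 ab b1 c0 cd d1 h /andP[cy yd].
set x := a + (b - a) / (d - c) * (val y - c).
have /andP[xa xb] : a <= x < b by apply: affine_itv => //; rewrite cy.
have x01 : 0 <= x < 1 by apply/andP; split; lra.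
pose X : unit_itv := exist _ x x01.
have fX : f X = y.
  apply: val_inj; rewrite /= h /= ?xa ?xb // /x /=; field.
  by apply/andP; split; apply: lt0r_neq0; lra.
by rewrite -fX /= ufunK.
Qed.

Inductive expands (T : tree) : tree -> Prop :=
| expands_refl : expands T T
| expands_attach U i : expands T U -> (i < nleaves U)%N ->
    expands T (attach U i).

Lemma expands_trans S T U : expands S T -> expands T U -> expands S U.
Proof. by move=> ST; elim=> // V i _ SV; exact: expands_attach. Qed.

Lemma expands_node l l' r r' :
  expands l l' -> expands r r' -> expands (Node l r) (Node l' r').
Proof.
move=> ll' rr'; apply: (@expands_trans _ (Node l' r)).
  elim: ll' => [|U i _ IH iU]; first exact: expands_refl.
  have := expands_attach IH (_ : i < nleaves (Node U r))%N.
  by rewrite /= iU; apply; rewrite ltn_addr.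
elim: rr' => [|U i _ IH iU]; first exact: expands_refl.
have := expands_attach IH (_ : nleaves l' + i < nleaves (Node l' U))%N.
by rewrite /= ltn_add2l ifN -?leqNgt ?leq_addr // addKn; apply.
Qed.

Lemma expands_leaf T : expands Leaf T.
Proof.
elim: T => [|l IHl r IHr]; first exact: expands_refl.
apply: expands_trans (expands_node IHl IHr).
exact: (@expands_attach _ Leaf 0 (expands_refl _)).
Qed.

Lemma common_expansion S T : exists2 U, expands S U & expands T U.
Proof.
elim: S T => [|l IHl r IHr] T.
  by exists T; [exact: expands_leaf|exact: expands_refl].
case: T => [|l' r'].
  by exists (Node l r); [exact: expands_refl|exact: expands_leaf].
have [U lU l'U] := IHl l'; have [V rV r'V] := IHr r'.
by exists (Node U V); exact: expands_node.
Qed.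

Lemma represents_expand_plus t f U : represents t f -> expands (tplus t) U ->
  exists2 t', represents t' f & tplus t' = U.
Proof.
move=> tf; elim=> [|{}U i _ [t' t'f <-]]; first by exists t.
rewrite tplus_size => iU.
by exists (add_caret (Ordinal iU)) => //; exact: represents_add_caret.
Qed.

Lemma represents_expand_minus t f U : represents t f -> expands (tminus t) U ->
  exists2 t', represents t' f & tminus t' = U.
Proof.
move=> /represents_swap tf /(represents_expand_plus tf)
  [t' /represents_swap t'f <-].
by exists (swap_triple t'); rewrite // -[f]invgK.
Qed.

Lemma represents_mul t u f g : represents t f -> represents u g ->
  tminus u = tplus t -> exists v, represents v (f * g)%g.
Proof.
case: t u => n A B s An Bn [m C D p Cm Dm] /= + + DA.
have nm : m = n by rewrite -An -Dm DA.
move: p Cm Dm; rewrite nm => {m nm} p Cm Dm.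
subst D => /representsP /= hf /representsP /= hg.
exists (Triple (p * s)%g Cm Bn); apply/representsP => /= i x.
have iC : (i < nleaves C)%N by rewrite Cm.
have pA : (p i < nleaves A)%N by rewrite An.
have [_ ab _] := leaf_itv_bounds iC; have [_ cd _] := leaf_itv_bounds pA.
have {hg} := hg i x; have {hf} := hf (p i) (g x); rewrite permM.
case: (leaf_itv C i) (leaf_itv A _) (leaf_itv B _) ab cd => a b [c d] [c' d'] /=.
move=> ab cd hf hg hx; move: hf; rewrite hg // => ->.
  by field; apply/andP; split; apply: lt0r_neq0; lra.
exact: affine_itv.
Qed.

Definition inV : {pred ubij} := fun f => `[< exists t, represents t f >].

Lemma inV_group_closed : group_closed inV.
Proof.
split.
  apply/asboolP.
  exists (@Triple 1 Leaf Leaf 1%g erefl erefl); apply/representsP => i x /=.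
  by rewrite ord1 perm1 /= => _; field.
move=> f g /asboolP[t tf] /asboolP[u /represents_swap ug]; apply/asboolP.
have [U tU uU] := common_expansion (tplus t) (tminus (swap_triple u)).
have [t' t'f t'U] := represents_expand_plus tf tU.
have [u' u'g u'U] := represents_expand_minus ug uU.
by apply: (represents_mul t'f u'g); rewrite t'U.
Qed.

Record thompsonV := ThompsonV { vval :> ubij; vvalP : vval \in inV }.

HB.instance Definition _ := [isSub for vval].
HB.instance Definition _ := [Choice of thompsonV by <:].
HB.instance Definition _ :=
  SubChoice_isSubGroup.Build ubij inV thompsonV inV_group_closed.

(* Every element of V has exactly one reduced triple, so [exists] reads "the
   reduced triple of f". *)
Definition vecV : {pred thompsonV} := fun f =>
  `[< exists t, [/\ represents t f, reduced t & compatible_signs t] >].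

End UnitInterval.

(* Main.v *)
Require Import Defs.
From mathcomp Require Import all_boot all_order all_algebra all_fingroup.
From mathcomp Require Import boolp reals.
From mathcomp Require Import zify ring lra.
(* Again, since MathComp has its own [tsize] and [tperm]. *)
Import Defs.

(** Attaching a caret to a leaf of sign e replaces e by (e, -e) and leaves the
other signs alone, so the condition on signs is invariant under adding and
removing canceling carets.  An element is therefore in the subset as soon as
any of its triples satisfies the condition: cancel carets until the triple is
reduced.  Two elements have triples with a common middle tree, and there the
condition visibly passes to quotients. *)

Set Implicit Arguments.
Unset Strict Implicit.
Unset Printing Implicit Defensive.

Import Order.TTheory GRing.Theory Num.Theory.
Local Open Scope ring_scope.

(** The rule at the new vertex fixes the sign of its right leaf; for every old vertex the two leaves
    compared stay the same up to renumbering. If [k] is past the last leaf, both sides are the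
    default [true]. *)
Lemma nth_signs_attach T s i k : (i < nleaves T)%N ->
  nth true (signs s (attach T i)) k =
  if (k <= i)%N then nth true (signs s T) k
  else if k == i.+1 then ~~ nth true (signs s T) i
  else nth true (signs s T) k.-1.
Proof.
elim: T s i k => [|l IHl r IHr] s i k /=.
  by case: i => // _; case: k => [|[|k]] //=; rewrite !nth_nil.
move=> ilt; case: (ltnP i (nleaves l)) => il /=; rewrite !nth_cat !size_signs.
  rewrite nleaves_attach il; case: (ltnP k (nleaves l).+1) => kl.
    rewrite IHl //; case: (leqP k i) => ki.
      by rewrite (leq_ltn_trans ki il).
    by case: eqP => // ki1; rewrite (_ : (k.-1 < nleaves l)%N) //; lia.
  by rewrite !ifN; [congr nth|..]; lia.
rewrite (ltnNge i) il /=; case: (ltnP k (nleaves l)) => kl.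
  by rewrite ifT //; lia.
rewrite IHr; last by lia.
have -> : (k - nleaves l <= i - nleaves l)%N = (k <= i)%N by lia.
have -> : (k - nleaves l == (i - nleaves l).+1)%N = (k == i.+1) by lia.
case: ifP => // ki; case: eqP => // ki1.
by rewrite ifN; [congr nth|]; lia.
Qed.

(** [bump i.+1] is the renumbering of old leaves used by [add_caret]. Unlike for intervals, [k = i]
    is allowed, since the new left leaf inherits the sign of the split leaf. *)
Lemma nth_signs_bump T s i k : (i < nleaves T)%N ->
  nth true (signs s (attach T i)) (bump i.+1 k) = nth true (signs s T) k.
Proof.
move=> iT; rewrite nth_signs_attach // /bump.
by case: (ltnP i k) => ik; [rewrite !ifN //; lia | rewrite add0n ik].
Qed.

Lemma nth_signs_right T s i : (i < nleaves T)%N ->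
  nth true (signs s (attach T i)) i.+1 = ~~ nth true (signs s T) i.
Proof. by move=> iT; rewrite nth_signs_attach // ltnn eqxx. Qed.

(** Reading the signs at [tperm t i] removes the inverse permutation. The bit [b] is the global
    sign, [true] standing for a switch, so that composing triples adds these bits. *)
Lemma compatible_signsP t : compatible_signs t <->
  exists b, forall i, nth true (signs true (tminus t)) (tperm t i) =
                      b (+) nth true (signs true (tplus t)) i.
Proof.
split=> [[] /ffunP h|[[] h]].
- by exists false => i; have := h (tperm t i); rewrite !ffunE permK.
- by exists true => i; have := h (tperm t i); rewrite !ffunE permK => ->;
     rewrite addTb negbK.
- by right; apply/ffunP => j; rewrite !ffunE -{2}(permKV (tperm t) j) h
     addTb negbK.
- by left; apply/ffunP => j; rewrite !ffunE -{2}(permKV (tperm t) j) h.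
Qed.

Lemma compatible_add_caret t (i : 'I_(tsize t)) :
  compatible_signs (add_caret i) <-> compatible_signs t.
Proof.
case: t i => n A B s An Bn /= i.
have iA : (i < nleaves A)%N by rewrite An.
have jB : (s i < nleaves B)%N by rewrite Bn.
(* The same [b] serves both triples: at the new right leaves both signs are negated, which commutes
   with adding [b]. *)
split=> /compatible_signsP[b /= h]; apply/compatible_signsP; exists b => /= k.
  by have := h (lift (lift ord0 i) k); rewrite lift_perm_lift !nth_signs_bump.
case: (unliftP (lift ord0 i) k) => [k'|] -> {k}.
  by rewrite lift_perm_lift !nth_signs_bump.
by rewrite lift_perm_id !nth_signs_right // h addbN.
Qed.

Lemma compatible_swap t :
  compatible_signs t -> compatible_signs (swap_triple t).
Proof.
move=> /compatible_signsP[b h]; apply/compatible_signsP; exists b => /= i.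
by rewrite -{2}(permKV (tperm t) i) h addKb.
Qed.

Section Represents.
Variable R : realType.
Implicit Types (t u : triple) (f g : ubij R).

(** The halves of leaf [i] go affinely onto the corresponding halves of its image, with equal
    slopes, so the two formulas glue to a single one. *)
Lemma represents_remove_caret t f (i : 'I_(tsize t)) :
  represents (add_caret i) f -> represents t f.
Proof.
case: t i => n A B s An Bn /= i /representsP /= h.
apply/representsP => /= k x.
have iA : (i < nleaves A)%N by rewrite An.
have jB : (s i < nleaves B)%N by rewrite Bn.
have [_ ab _] := @leaf_itv_bounds R _ _ iA.
have [->|ki] := eqVneq k i; last first.
  have := h (lift (lift ord0 i) k) x; rewrite lift_perm_lift /=.
  by rewrite !leaf_itv_bump // (inj_eq val_inj) (inj_eq perm_inj).
(* These are the two new leaves: the left one has number [i], the right one [i+1]. *)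
have := h (lift (lift ord0 i) i) x; have := h (lift ord0 i) x.
have bumpE m : bump (bump 0 m) m = m by rewrite /bump; lia.
have bump0 m : bump 0 m = m.+1 by [].
rewrite lift_perm_lift lift_perm_id /= !bumpE !bump0 !leaf_itv_attach //.
rewrite !ltnn !(ltnNge _.+1) !leqnSn !eqxx !(gtn_eqF (ltnSn _)) /=.
move=> hr hl /andP[ax xb].
have [xm|mx] := ltP (val x) (((leaf_itv R A i).1 + (leaf_itv R A i).2) / 2).
  by rewrite hl ?ax //; field; apply: lt0r_neq0; lra.
by rewrite hr ?mx //; field; apply: lt0r_neq0; lra.
Qed.

Definition oriented t f := represents t f /\ compatible_signs t.

Lemma oriented_swap t f : oriented t f -> oriented (swap_triple t) (f^-1)%g.
Proof. by case=> /represents_swap ? /compatible_swap. Qed.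

(** Each cancellation lowers the number of leaves by one, so the process stops. *)
Lemma oriented_reduced t f : oriented t f ->
  exists2 t', oriented t' f & reduced t'.
Proof.
have [n] := ubnP (tsize t); elim: n t => // n IHn t tn tf.
have [[t0 [i tE]]|] := EM (exists t0 (i : 'I_(tsize t0)), t = add_caret i).
  apply: (IHn t0); first by move: tn; rewrite tE.
  move: tf; rewrite tE.
  by case=> /represents_remove_caret ? /compatible_add_caret.
by exists t.
Qed.

Lemma oriented_expand_plus t f U : oriented t f -> expands (tplus t) U ->
  exists2 t', oriented t' f & tplus t' = U.
Proof.
move=> tf; elim=> [|{}U i _ [t' [t'f t's] <-]]; first by exists t.
rewrite tplus_size => iU; exists (add_caret (Ordinal iU)) => //.
by split; [exact: represents_add_caret | exact/compatible_add_caret].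
Qed.

(** The triple given by [represents_mul] is hidden behind an existential, so it is built again here
    to read off its signs. *)
Lemma oriented_mul t u f g : oriented t f -> oriented u g ->
  tminus u = tplus t -> exists v, oriented v (f * g)%g.
Proof.
case: t => n A B s An Bn; case: u => m C D p Cm Dm /= + + DA.
have nm : m = n by rewrite -An -Dm DA.
move: p Cm Dm; rewrite {}nm => p Cm Dm; subst D.
move=> -[/representsP /= hf /compatible_signsP[b /= bs]].
move=> [/representsP /= hg /compatible_signsP[c /= cs]].
(* A product of permutations applies its left factor first, a product in [ubij] its right one. *)
exists (Triple (p * s)%g Cm Bn); split; last first.
  apply/compatible_signsP; exists (b (+) c) => i /=.
  by rewrite permM bs cs addbA.
apply/representsP => /= i x hx.
have iC : (i < nleaves C)%N by rewrite Cm.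
have pA : (p i < nleaves A)%N by rewrite An.
have [_ ab _] := @leaf_itv_bounds R _ _ iC.
have [_ cd _] := @leaf_itv_bounds R _ _ pA.
have gx := hg i x hx; rewrite permM (hf (p i)) gx; last exact: affine_itv.
by field; apply/andP; split; apply: lt0r_neq0; lra.
Qed.

(** This is the closure that [group_closed] asks for. Both plus trees are expanded to a common [U];
    swapping the triple of [g] afterwards makes [U] the minus tree of a triple of [g^-1]. *)
Lemma oriented_div t u f g : oriented t f -> oriented u g ->
  exists v, oriented v (f * g^-1)%g.
Proof.
move=> tf ug; have [U tU uU] := common_expansion (tplus t) (tplus u).
have [t' t'f t'U] := oriented_expand_plus tf tU.
have [u' /oriented_swap u'g u'U] := oriented_expand_plus ug uU.
by apply: oriented_mul t'f u'g _; rewrite t'U.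
Qed.

Lemma oriented1 : oriented (@Triple 1 Leaf Leaf 1%g erefl erefl) 1%g.
Proof.
split; first by apply/representsP => i x /=; rewrite ord1 perm1 /= => _; field.
by apply/compatible_signsP; exists false => i; rewrite /= perm1.
Qed.

Lemma vecVP (f : thompsonV R) :
  f \in @vecV R <-> exists t, oriented t f.
Proof.
split=> [/asboolP[t [tf _ ts]]|[t /oriented_reduced[t' [t'f t's] t'r]]].
  by exists t.
by apply/asboolP; exists t'.
Qed.

End Represents.

Theorem proposition4p1p5 (R : realType) : group_closed (@vecV R).
Proof.
split=> [|f g /vecVP[t tf] /vecVP[u ug]]; apply/vecVP.
  by eexists; exact: oriented1.
exact: oriented_div tf ug.
Qed.
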